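(* Let $\mathfrak{A}$ be a unital $C^*$-algebra with unit $1$, let $a\in\mathfrak{A}$ be such that $a$ and $1-a$ are invertible, and let $\mathscr{E},\mathscr{G}$ be inner product $\mathfrak{A}$-modules. If $A:\mathscr{E}\to\mathscr{G}$ is $a$-additive and $B:\mathscr{E}\times\mathscr{E}\to\mathscr{G}$ is $a$-biadditive and orthogonality preserving, then any mapping $f:\mathscr{E}\to\mathscr{G}$ satisfying $$f(x)=A(x)+B(x,x)+f(0)\qquad(x\in\mathscr{E})$$ is orthogonally $a$-Jensen.
   Context: An inner product $\mathfrak{A}$-module is here a complex vector space $\mathscr{E}$ that is a left $\mathfrak{A}$-module (with compatible scalar multiplication), equipped with an $\mathfrak{A}$-valued inner product $\langle\cdot,\cdot\rangle$ that is $\mathbb{C}$-linear and $\mathfrak{A}$-linear in the first variable, satisfies $\langle x,y\rangle^*=\langle y,x\rangle$, and $\langle x,x\rangle\ge 0$ with equality if and only if $x=0$. Thus $\langle cx,dy\rangle=c\langle x,y\rangle d^*$ for $c,d\in\mathfrak{A}$. Completeness is not assumed. A mapping $f:\mathscr{E}\to\mathscr{G}$ is orthogonally $a$-Jensen if for all $x,y\in\mathscr{E}$, $\langle x,y\rangle=0$ implies $f(ax+(1-a)y)=af(x)+(1-a)f(y)$. An additive mapping $A:\mathscr{E}\to\mathscr{G}$ is $a$-additive if $A(ax)=aA(x)$ for all $x\in\mathscr{E}$. A biadditive mapping $B:\mathscr{E}\times\mathscr{E}\to\mathscr{G}$ is $a$-biadditive if $B(ax,ax)=aB(x,x)$ and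 $B((1-a)x,(1-a)x)=(1-a)B(x,x)$ for all $x\in\mathscr{E}$. $B$ is orthogonality preserving if for all $x,y\in\mathscr{E}$, $\langle x,y\rangle=0$ implies $B(x,y)=0$. *)

(* Defs.v *)
From HB Require Import structures.
From mathcomp Require Import all_boot all_order all_algebra.
From mathcomp Require Import boolp classical_sets reals topology normedtype.
From mathcomp Require Import complex.

Set Implicit Arguments.
Unset Strict Implicit.
Unset Printing Implicit Defensive.

Import Order.TTheory GRing.Theory Num.Theory.
Import numFieldNormedType.Exports.

Local Open Scope ring_scope.
Local Open Scope complex_scope.

(* MathComp has no join of rings and normed modules, hence the explicit
   multiplication; the ring structure is declared on [cstar_sort] below.
   The norm of a normed module over R[i] takes its values in R[i], where
   0 <= `|x| makes it real. The zero algebra is allowed. *)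
Record unitalCStarAlgebra (R : realType) := UnitalCStarAlgebra {
  cstar_space : completeNormedModType R[i];
  cstar_mul : cstar_space -> cstar_space -> cstar_space;
  cstar_one : cstar_space;
  cstar_mulA : associative cstar_mul;
  cstar_mul1 : left_id cstar_one cstar_mul;
  cstar_mulr1 : right_id cstar_one cstar_mul;
  cstar_mulDl : left_distributive cstar_mul +%R;
  cstar_mulDr : right_distributive cstar_mul +%R;
  cstar_scalerAl : forall (k : R[i]) x y,
    k *: cstar_mul x y = cstar_mul (k *: x) y;
  cstar_scalerAr : forall (k : R[i]) x y,
    k *: cstar_mul x y = cstar_mul x (k *: y);
  cstar_star : cstar_space -> cstar_space;
  cstar_starD : {morph cstar_star : x y / x + y};
  cstar_starZ : forall (k : R[i]) x,
    cstar_star (k *: x) = Num.conj k *: cstar_star x;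
  cstar_starM : forall x y,
    cstar_star (cstar_mul x y) = cstar_mul (cstar_star y) (cstar_star x);
  cstar_starK : involutive cstar_star;
  cstar_normM : forall x y, `|cstar_mul x y| <= `|x| * `|y|;
  cstar_norm : forall x, `|cstar_mul (cstar_star x) x| = `|x| ^+ 2
}.

Definition cstar_sort (R : realType) (A : unitalCStarAlgebra R) : Type :=
  cstar_space A.
Coercion cstar_sort : unitalCStarAlgebra >-> Sortclass.

HB.instance Definition _ (R : realType) (A : unitalCStarAlgebra R) :=
  CompleteNormedModule.copy (cstar_sort A) (cstar_space A).
HB.instance Definition _ (R : realType) (A : unitalCStarAlgebra R) :=
  GRing.Zmodule_isPzRing.Build (cstar_sort A)
    (@cstar_mulA R A) (@cstar_mul1 R A) (@cstar_mulr1 R A)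
    (@cstar_mulDl R A) (@cstar_mulDr R A).

Definition star (R : realType) (A : unitalCStarAlgebra R) (x : A) : A :=
  cstar_star x.

(* [GRing.unit] is only available on nonzero rings. *)
Definition invertible (A : pzRingType) (x : A) : Prop :=
  exists y : A, x * y = 1 /\ y * x = 1.

Definition spectrum (R : realType) (A : unitalCStarAlgebra R) (x : A)
  : set R[i] := [set k : R[i] | ~ invertible (k *: (1 : A) - x)]%classic.

(* In R[i], [0 <= k] means that k is real and nonnegative. *)
Definition cstar_ge0 (R : realType) (A : unitalCStarAlgebra R) (x : A) : Prop :=
  star x = x /\ forall k : R[i], spectrum x k -> 0 <= k.

(* [*:] is the action of A; since one type cannot carry two [lmodType]
   structures, the complex vector space structure is given by [cscale]. *)
HB.mixin Record isInnerProductModule (R : realType) (A : unitalCStarAlgebra R) E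
    of GRing.Lmodule A E := {
  cscale : R[i] -> E -> E;
  cscaleA : forall (k l : R[i]) (x : E), cscale k (cscale l x) = cscale (k * l) x;
  cscale1 : forall x : E, cscale 1 x = x;
  cscaleDr : forall (k : R[i]) (x y : E),
    cscale k (x + y) = cscale k x + cscale k y;
  cscaleDl : forall (k l : R[i]) (x : E),
    cscale (k + l) x = cscale k x + cscale l x;
  cscale_scalel : forall (k : R[i]) (c : A) (x : E),
    cscale k (c *: x) = (k *: c) *: x;
  cscale_scaler : forall (k : R[i]) (c : A) (x : E),
    cscale k (c *: x) = c *: cscale k x;
  inner : E -> E -> A;
  innerDl : forall x y z : E, inner (x + y) z = inner x z + inner y z;
  inner_cscalel : forall (k : R[i]) (x y : E),
    inner (cscale k x) y = k *: inner x y;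
  inner_scalel : forall (c : A) (x y : E), inner (c *: x) y = c * inner x y;
  star_inner : forall x y : E, star (inner x y) = inner y x;
  inner_ge0 : forall x : E, cstar_ge0 (inner x x);
  inner_eq0 : forall x : E, inner x x = 0 <-> x = 0
}.

#[short(type="innerProductModType")]
HB.structure Definition InnerProductModule (R : realType)
    (A : unitalCStarAlgebra R) :=
  {E of GRing.Lmodule A E & isInnerProductModule R A E}.

Section Mappings.
Variables (R : realType) (A : unitalCStarAlgebra R).
Variables (E G : innerProductModType A).
Implicit Types (a : A) (x y z : E).

Definition orthogonal x y : Prop := inner x y = 0.

Definition orthogonally_jensen a (f : E -> G) : Prop :=
  forall x y, orthogonal x y ->
    f (a *: x + (1 - a) *: y) = a *: f x + (1 - a) *: f y.

Definition a_additive a (f : E -> G) : Prop :=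
  {morph f : x y / x + y} /\ forall x, f (a *: x) = a *: f x.

Definition biadditive (B : E -> E -> G) : Prop :=
  (forall x y z, B (x + y) z = B x z + B y z) /\
  (forall x y z, B x (y + z) = B x y + B x z).

Definition a_biadditive a (B : E -> E -> G) : Prop :=
  [/\ biadditive B,
      forall x, B (a *: x) (a *: x) = a *: B x x &
      forall x, B ((1 - a) *: x) ((1 - a) *: x) = (1 - a) *: B x x].

Definition orthogonality_preserving (B : E -> E -> G) : Prop :=
  forall x y, orthogonal x y -> B x y = 0.

End Mappings.

(* Main.v *)
Require Import Defs.
From HB Require Import structures.
From mathcomp Require Import all_boot all_order all_algebra.
From mathcomp Require Import boolp classical_sets reals topology normedtype.
From mathcomp Require Import complex.

Import Order.TTheory GRing.Theory Num.Theory.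

Local Open Scope ring_scope.

(** The Jensen identity is linear in [f], so it may be checked on the three summands. An
    [a]-additive map commutes with [1 - a] as well ([a_additive_compl]), and a constant is handled
    by [a + (1 - a) = 1]. For the diagonal of [B], the vectors [a *: x] and [(1 - a) *: y] remain
    orthogonal ([orthogonal_scale]), so the cross terms vanish ([biadditive_diagD]). *)

Lemma star0 (R : realType) (A : unitalCStarAlgebra R) : star (0 : A) = 0.
Proof.
by apply: (addrI (star (0 : A))); rewrite addr0 -[RHS](congr1 _ (addr0 (0 : A)))
  [RHS]cstar_starD.
Qed.

Section Orthogonality.
Context {R : realType} {A : unitalCStarAlgebra R} {E : innerProductModType A}.
Implicit Types (c d : A) (x y : E).

Lemma orthogonal_sym x y : Defs.orthogonal x y -> Defs.orthogonal y x.
Proof.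
by rewrite /Defs.orthogonal -[inner y x]star_inner => ->; apply: star0.
Qed.

Lemma orthogonal_scalel c x y :
  Defs.orthogonal x y -> Defs.orthogonal (c *: x) y.
Proof. by rewrite /Defs.orthogonal inner_scalel => ->; rewrite mulr0. Qed.

(** The inner product is linear on the left only; the right scalar is reached by swapping the
    arguments, scaling, and swapping back. *)
Lemma orthogonal_scale c d x y :
  Defs.orthogonal x y -> Defs.orthogonal (c *: x) (d *: y).
Proof.
by move=> /(orthogonal_scalel c) /orthogonal_sym /(orthogonal_scalel d)
  /orthogonal_sym.
Qed.

End Orthogonality.

Section Mappings.
Context {R : realType} {A : unitalCStarAlgebra R} {E G : innerProductModType A}.
Implicit Types (a : A) (x y : E).

(** Adding [f (a *: x) = a *: f x] to the claim turns both sides into [f x]. *)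
Lemma a_additive_compl a (f : E -> G) x :
  a_additive a f -> f ((1 - a) *: x) = (1 - a) *: f x.
Proof.
case=> fD fa; apply: (addrI (a *: f x)).
by rewrite -{1}fa -fD -!scalerDl subrKC !scale1r.
Qed.

(** Both cross terms vanish because orthogonality is symmetric, although [B] need not be. *)
Lemma biadditive_diagD (B : E -> E -> G) x y :
  biadditive B -> orthogonality_preserving B -> Defs.orthogonal x y ->
  B (x + y) (x + y) = B x x + B y y.
Proof.
case=> BDl BDr Borth xy; rewrite BDl !BDr (Borth x y xy).
by rewrite (Borth y x (orthogonal_sym _ _ xy)) addr0 add0r.
Qed.

End Mappings.

Theorem mainTheorem2 (R : realType) (A : unitalCStarAlgebra R) (a : A)
    (E G : innerProductModType A) (Add : E -> G) (B : E -> E -> G) (f : E -> G) :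
  invertible a -> invertible (1 - a) ->
  a_additive a Add ->
  a_biadditive a B -> orthogonality_preserving B ->
  (forall x : E, f x = Add x + B x x + f 0) ->
  orthogonally_jensen a f.
Proof.
move=> _ _ Aadd [Bbi Ba Bcompl] Borth fE x y xy.
have Acompl := a_additive_compl a Add y Aadd; case: Aadd => AD Aa.
rewrite fE (fE x) (fE y) AD Aa Acompl.
rewrite biadditive_diagD //; last exact: orthogonal_scale.
rewrite Ba Bcompl !scalerDr.
(* Only the constant on the left is split; the right side already carries its two weighted
   copies. *)
have {1}-> : f 0 = a *: f 0 + (1 - a) *: f 0 by rewrite -scalerDl subrKC scale1r.
by rewrite (addrACA (a *: Add x)) -(addrACA _ (a *: f 0)).
Qed.
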